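(* Assume $\operatorname{cov}\mathcal{M}<\mathfrak{c}$. Then for every $s>0$ there exists a separable metric space $X$ with $\dim_H X\ge s$ and cardinality $|X|<\mathfrak{c}$; consequently there is no function (of any kind) from $X$ onto a non-degenerate interval of $\mathbb{R}$.
   Context: $\mathfrak{c}$ is the cardinality of the continuum, $\mathcal{M}$ is the collection of first category (meager) subsets of $\mathbb{R}$, and $\operatorname{cov}\mathcal{M}$ is the least cardinality of a family of first category subsets of $\mathbb{R}$ whose union is $\mathbb{R}$. $\dim_H$ denotes Hausdorff dimension. *)

(* Defs.v *)
From Stdlib Require Import Reals.
Open Scope R_scope.

Definition injective {A B : Type} (f : A -> B) : Prop :=
  forall x y, f x = f y -> x = y.

Definition card_lt (A B : Type) : Prop :=
  (exists f : A -> B, injective f) /\ ~ (exists g : B -> A, injective g).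

Definition countable_set {X : Type} (D : X -> Prop) : Prop :=
  exists f : X -> nat, forall x y, D x -> D y -> f x = f y -> x = y.

Definition closure_R (A : R -> Prop) (x : R) : Prop :=
  forall eps, 0 < eps -> exists y, A y /\ Rabs (x - y) < eps.

Definition nowhere_dense (A : R -> Prop) : Prop :=
  ~ (exists x eps, 0 < eps /\ forall y, Rabs (y - x) < eps -> closure_R A y).

Definition meager (A : R -> Prop) : Prop :=
  exists N : nat -> (R -> Prop),
    (forall n, nowhere_dense (N n)) /\ (forall x, A x -> exists n, N n x).

Definition cov_M_lt_c : Prop :=
  exists (I : Type) (F : I -> (R -> Prop)),
    card_lt I R /\ (forall i, meager (F i)) /\ (forall x, exists i, F i x).

Definition is_metric {X : Type} (d : X -> X -> R) : Prop :=
  (forall x y, 0 <= d x y) /\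
  (forall x y, d x y = 0 <-> x = y) /\
  (forall x y, d x y = d y x) /\
  (forall x y z, d x z <= d x y + d y z).

Definition separable {X : Type} (d : X -> X -> R) : Prop :=
  exists D : X -> Prop, countable_set D /\
    forall x eps, 0 < eps -> exists y, D y /\ d x y < eps.

Definition diam_le {X : Type} (d : X -> X -> R) (U : X -> Prop) (r : R) : Prop :=
  forall x y, U x -> U y -> d x y <= r.

Definition Hdelta_null {X : Type} (d : X -> X -> R) (t delta : R) : Prop :=
  forall eps, 0 < eps ->
    exists (U : nat -> X -> Prop) (r : nat -> R),
      (forall x, exists n, U n x) /\
      (forall n, 0 < r n /\ r n <= delta /\ diam_le d (U n) (r n)) /\
      exists l, l < eps /\ forall N, sum_f_R0 (fun n => Rpower (r n) t) N <= l.

Definition Hausdorff_null {X : Type} (d : X -> X -> R) (t : R) : Prop :=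
  forall delta, 0 < delta -> Hdelta_null d t delta.

(* dim_H X = inf { t > 0 | H^t(X) = 0 }  (inf of empty = +oo);
   dim_H X >= s  iff  H^t(X) <> 0 for all 0 < t < s *)
Definition dimH_ge {X : Type} (d : X -> X -> R) (s : R) : Prop :=
  forall t, 0 < t -> t < s -> ~ Hausdorff_null d t.

Definition interval (I : R -> Prop) : Prop :=
  forall x y z, I x -> I z -> x <= y <= z -> I y.

Definition nondegenerate (I : R -> Prop) : Prop :=
  exists x y, I x /\ I y /\ x < y.

Definition maps_onto {X : Type} (f : X -> R) (I : R -> Prop) : Prop :=
  (forall x, I (f x)) /\ (forall y, I y -> exists x, f x = y).

(* Main.v *)
(** Write kappa for the size of the given meager cover, indexed by [I].  The key
    is one half of Bartoszynski's characterization of cov(M): there is an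
    [I]-indexed family in Baire space such that no single [g] agrees infinitely
    often with every member.  If instead every [I]-indexed family could be
    guessed infinitely often, then guessing a growth rate and afterwards, along
    that rate, the strategies "shrink this rational interval so as to avoid the
    first [k] nowhere dense pieces" would produce a real outside all the meager
    sets.

    An unguessable family is regrouped so that its [m]-th coordinate carries
    [K m] values of the original one, with [K] growing faster than a power
    depending on [s].  In Baire space with distance [1/(m+1)], [m] the first
    difference, at most [K m] sets of a cover with small [t]-sum have diameter
    about [1/(m+1)], so a sequence of finer and finer covers would yield a
    guess. *)

Require Import Defs.
From Stdlib Require Import Reals Lra Lia List Arith ZArith Cantor.
From Stdlib Require Import Classical ClassicalEpsilon FunctionalExtensionality.
Open Scope R_scope.

(** * Choice and least witnesses *)

Lemma choice_fun {A B : Type} (P : A -> B -> Prop) :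
  (forall x, exists y, P x y) -> exists f : A -> B, forall x, P x (f x).
Proof.
  intros H.
  exists (fun x => proj1_sig (constructive_indefinite_description _ (H x))).
  intros x. exact (proj2_sig (constructive_indefinite_description _ (H x))).
Qed.

Lemma least_nat (P : nat -> Prop) :
  (exists n, P n) -> exists n, P n /\ forall k, (k < n)%nat -> ~ P k.
Proof.
  intros [n Hn]. revert Hn.
  induction n as [n IH] using (well_founded_induction lt_wf). intros Hn.
  destruct (classic (exists k, (k < n)%nat /\ P k)) as [[k [Hk Pk]]|H].
  - exact (IH k Hk Pk).
  - exists n. split; [exact Hn|]. intros k Hk Pk. apply H. eauto.
Qed.

(** * Guessing families of functions *)

Definition guessable (I : Type) : Prop :=
  forall y : I -> nat -> nat, exists g : nat -> nat,
    forall i n, exists m, (n <= m)%nat /\ y i m = g m.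

Fixpoint enc_list {A : Type} (enc : A -> nat) (l : list A) : nat :=
  match l with
  | nil => 0%nat
  | a :: l' => S (to_nat (enc a, enc_list enc l'))
  end.

Lemma to_nat_inj p q : to_nat p = to_nat q -> p = q.
Proof. intros H. rewrite <- (cancel_of_to p), <- (cancel_of_to q), H. reflexivity. Qed.

Lemma enc_list_inj {A : Type} (enc : A -> nat) :
  injective enc -> injective (enc_list enc).
Proof.
  intros He l. induction l as [|a l IH]; intros [|b l'] H; try discriminate; auto.
  apply eq_add_S, to_nat_inj in H.
  injection H as H1 H2. f_equal; auto.
Qed.

Definition enc_pair {A : Type} (enc : A -> nat) (p : nat * A) : nat :=
  to_nat (fst p, enc (snd p)).

Lemma enc_pair_inj {A : Type} (enc : A -> nat) :
  injective enc -> injective (enc_pair enc).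
Proof.
  intros He [a b] [a' b'] H. unfold enc_pair in H. apply to_nat_inj in H. simpl in H.
  injection H as -> H. f_equal; auto.
Qed.

Lemma guessable_countable (I S : Type) (s0 : S) (enc : S -> nat) :
  guessable I -> injective enc ->
  forall y : I -> nat -> S, exists g : nat -> S,
    forall i n, exists m, (n <= m)%nat /\ y i m = g m.
Proof.
  intros HG He y.
  destruct (HG (fun i n => enc (y i n))) as [g Hg].
  destruct (choice_fun (fun n v => forall u, enc u = g n -> u = v)) as [h Hh].
  { intros n. destruct (classic (exists u, enc u = g n)) as [[u Hu]|H].
    - exists u. intros v Hv. apply He. congruence.
    - exists s0. intros u Hu. exfalso. eauto. }
  exists h. intros i n. destruct (Hg i n) as [m [Hm E]]. eauto.
Qed.

(** Adding one to every value of [g] before summing makes the sums strictly increasing and strictly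
    larger than [g]. *)
Fixpoint partial_sum (g : nat -> nat) (n : nat) : nat :=
  match n with
  | O => S (g O)
  | S k => (partial_sum g k + S (g (S k)))%nat
  end.

Lemma guessable_not_dominating (I : Type) :
  guessable I -> forall e : I -> nat -> nat, exists n : nat -> nat,
    (forall k, n k < n (S k))%nat /\
    forall i M, exists m, (M <= m)%nat /\ (e i m < n m)%nat.
Proof.
  intros HG e. destruct (HG e) as [g Hg].
  exists (partial_sum g). split.
  - intros k. simpl. lia.
  - intros i M. destruct (Hg i M) as [m [Hm E]]. exists m. split; [exact Hm|].
    rewrite E. destruct m; simpl; lia.
Qed.

Lemma iter_mono (h : nat -> nat) :
  (forall a b, a <= b -> h a <= h b)%nat ->
  forall j a b, (a <= b)%nat -> (Nat.iter j h a <= Nat.iter j h b)%nat.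
Proof. intros Hh j. induction j; simpl; auto. Qed.

Lemma iter_infl (h : nat -> nat) :
  (forall a, a <= h a)%nat ->
  forall j m a, (j <= m)%nat -> (Nat.iter j h a <= Nat.iter m h a)%nat.
Proof.
  intros Hh j m a H. induction H; [lia|].
  simpl. eapply Nat.le_trans; [exact IHle|apply Hh].
Qed.

(** If [n (S k) < h i (n k)] from [M] on, then [n] grows no faster than the iterates of [h i]
    started at [n M], and these are eventually below the [m]-fold iterate at [m]. So it suffices
    that [n] exceeds this diagonal infinitely often. *)
Lemma guessable_jump (I : Type) (h : I -> nat -> nat) :
  guessable I ->
  (forall i a b, a <= b -> h i a <= h i b)%nat ->
  (forall i a, a <= h i a)%nat ->
  exists n : nat -> nat,
    (forall k, n k < n (S k))%nat /\
    forall i M, exists k, (M <= k)%nat /\ (h i (n k) <= n (S k))%nat.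
Proof.
  intros HG Hm Hi.
  destruct (guessable_not_dominating I HG (fun i m => Nat.iter m (h i) m))
    as [n [Hn He]].
  exists n. split; [exact Hn|]. intros i M.
  apply NNPP. intros Hno.
  assert (Hlt : forall k, (M <= k)%nat -> (n (S k) < h i (n k))%nat).
  { intros k Hk. destruct (le_lt_dec (h i (n k)) (n (S k))); auto.
    exfalso. eauto. }
  assert (Hit : forall j, (n (M + j) <= Nat.iter j (h i) (n M))%nat).
  { induction j as [|j IH]; [rewrite Nat.add_0_r; simpl; lia|].
    rewrite Nat.add_succ_r. simpl.
    specialize (Hlt (M + j)%nat ltac:(lia)).
    specialize (Hm i _ _ IH). lia. }
  (* With [m >= M + n M], both the number [m - M] of iterations and the starting value [n M] are at
     most [m]. *)
  destruct (He i (M + n M)%nat) as [m [H1 H2]].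
  specialize (Hit (m - M)%nat). replace (M + (m - M))%nat with m in Hit by lia.
  pose proof (iter_mono (h i) (Hm i) (m - M) (n M) m ltac:(lia)).
  pose proof (iter_infl (h i) (Hi i) (m - M) m m ltac:(lia)).
  lia.
Qed.

Lemma infinite_lists (A : nat -> Prop) :
  (forall M, exists m, (M <= m)%nat /\ A m) ->
  forall p q, exists l, length l = p /\ NoDup l /\
    forall a, In a l -> (q <= a)%nat /\ A a.
Proof.
  intros HA p. induction p as [|p IH]; intros q.
  - exists nil. repeat split; try constructor; contradiction.
  - destruct (HA q) as [m [Hm Am]]. destruct (IH (S m)) as [l [Hl [Hd Hin]]].
    exists (m :: l). repeat split.
    + simpl. congruence.
    + constructor; auto. intros Hi. apply Hin in Hi. lia.
    + destruct H as [->|H]; [lia|]. apply Hin in H. lia.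
    + destruct H as [->|H]; [exact Am|]. apply Hin in H. tauto.
Qed.

Lemma fresh_key {S : Type} (l used : list (nat * S)) :
  NoDup (map fst l) -> (length used < length l)%nat ->
  exists p, In p l /\ ~ In (fst p) (map fst used).
Proof.
  intros Hd Hl. apply NNPP. intros Hno.
  assert (Hi : incl (map fst l) (map fst used)).
  { intros a Ha. apply in_map_iff in Ha. destruct Ha as [p [<- Hp]].
    apply NNPP. intros Hn. apply Hno. eauto. }
  apply (NoDup_incl_length Hd) in Hi. rewrite !length_map in Hi. lia.
Qed.

(* A guess made at step [q] lists [q + 1] arguments together with their values,
   so at least one of these arguments was not used by an earlier guess. *)
Lemma guessable_on (I S : Type) (s0 : S) (enc : S -> nat) (A : I -> nat -> Prop) :
  guessable I -> injective enc ->
  (forall i M, exists m, (M <= m)%nat /\ A i m) ->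
  forall y : I -> nat -> S, exists g : nat -> S,
    forall i M, exists m, (M <= m)%nat /\ A i m /\ y i m = g m.
Proof.
  intros HG He HA y.
  destruct (choice_fun (fun (iq : I * nat) l =>
     length l = Datatypes.S (snd iq) /\ NoDup l /\
     forall a, In a l -> (snd iq <= a)%nat /\ A (fst iq) a)) as [L HL].
  { intros [i q]. apply infinite_lists, HA. }
  destruct (guessable_countable I (list (nat * S)) nil (enc_list (enc_pair enc)) HG
              (enc_list_inj _ (enc_pair_inj _ He))
              (fun i q => map (fun a => (a, y i a)) (L (i, q)))) as [T HT].
  (* [step] adds to the table at most one pair, always with a new key, and adds one from the guessed
     list whenever that list offers a new key. *)
  destruct (choice_fun (fun (ul : list (nat * S) * list (nat * S)) u' =>
     ((exists p, In p (snd ul) /\ ~ In (fst p) (map fst (fst ul))) ->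
       exists p, In p (snd ul) /\ ~ In (fst p) (map fst (fst ul)) /\ u' = p :: fst ul) /\
     (u' = fst ul \/ exists p, ~ In (fst p) (map fst (fst ul)) /\ u' = p :: fst ul)))
    as [step Hstep].
  { intros [u l]. simpl.
    destruct (classic (exists p, In p l /\ ~ In (fst p) (map fst u))) as [[p [H1 H2]]|H].
    - exists (p :: u). split; [|right]; eauto.
    - exists u. tauto. }
  pose (used := fix used q := match q with
                | O => nil
                | Datatypes.S k => step (used k, T k) end).
  assert (Hu : forall q, (length (used q) <= q)%nat /\ NoDup (map fst (used q))).
  { induction q as [|q [IH1 IH2]]; simpl; [split; [lia|constructor]|].
    destruct (proj2 (Hstep (used q, T q))) as [->|[p [Hp ->]]]; simpl in *.
    - split; [lia|auto].
    - split; [lia|constructor; auto]. }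
  assert (Hmon : forall q q' p, (q <= q')%nat -> In p (used q) -> In p (used q')).
  { intros q q' p H Hp. induction H as [|q' H IH]; auto. simpl.
    destruct (proj2 (Hstep (used q', T q'))) as [->|[p' [_ ->]]]; simpl; auto. }
  assert (Huniq : forall (l : list (nat * S)) a v w, NoDup (map fst l) ->
            In (a, v) l -> In (a, w) l -> v = w).
  { intros l a v w. induction l as [|[b z] l IH]; simpl; intros Hd Hv Hw; [tauto|].
    inversion Hd as [|? ? Hn Hd']; subst.
    assert (Hk : forall u, In (a, u) l -> In a (map fst l))
      by (intros u Hin; exact (in_map fst _ _ Hin)).
    destruct Hv as [Hv|Hv], Hw as [Hw|Hw]; auto.
    - congruence.
    - injection Hv as <- <-. exfalso. eauto.
    - injection Hw as <- <-. exfalso. eauto. }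
  destruct (choice_fun (fun a v => forall q w, In (a, w) (used q) -> w = v)) as [g Hg].
  { intros a. destruct (classic (exists q w, In (a, w) (used q))) as [[q [w Hw]]|H].
    - exists w. intros q' w' Hw'.
      apply (Huniq (used (q + q')%nat) a); [apply Hu| |].
      + apply (Hmon q'); auto; lia.
      + apply (Hmon q); auto; lia.
    - exists s0. intros q w Hw. exfalso. eauto. }
  exists g. intros i M. destruct (HT i M) as [q [Hq E]].
  destruct (HL (i, q)) as [Hlen [Hnd Hin]]. simpl in *.
  destruct (proj1 (Hstep (used q, T q))) as [p [Hp [_ Ep]]]; simpl in *.
  { apply fresh_key.
    - rewrite <- E, map_map. simpl. rewrite map_id. exact Hnd.
    - rewrite <- E, length_map, Hlen. pose proof (proj1 (Hu q)). lia. }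
  rewrite <- E in Hp. apply in_map_iff in Hp. destruct Hp as [a [<- Ha]].
  destruct (Hin a Ha) as [H1 H2]. exists a. split; [lia|]. split; [exact H2|].
  apply (Hg a (Datatypes.S q)). simpl. rewrite Ep. simpl. auto.
Qed.

(** Take the maximum of [f] over all pairs up to [n]; these squares are nested, and the added [n]
    gives [a <= h a]. *)
Lemma square_bound (f : nat -> nat -> nat) :
  exists h : nat -> nat,
    (forall a b, a <= b -> h a <= h b)%nat /\ (forall a, a <= h a)%nat /\
    forall j k n, (j <= n -> k <= n -> f j k <= h n)%nat.
Proof.
  pose (l := fun n => map (fun p => f (fst p) (snd p))
                        (list_prod (seq 0 (S n)) (seq 0 (S n)))).
  assert (Hl : forall n v, In v (l n) <->
    exists j k, (j <= n)%nat /\ (k <= n)%nat /\ v = f j k).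
  { intros n v. unfold l. rewrite in_map_iff. split.
    - intros [[j k] [<- H]]. apply in_prod_iff in H. rewrite !in_seq in H.
      exists j, k. simpl. lia.
    - intros [j [k [H1 [H2 ->]]]]. exists (j, k). split; [reflexivity|].
      apply in_prod_iff. rewrite !in_seq. lia. }
  assert (Hmax : forall n v, In v (l n) -> (v <= list_max (l n))%nat).
  { intros n v Hv. pose proof (proj1 (list_max_le (l n) _) (le_n _)) as HF.
    rewrite Forall_forall in HF. auto. }
  exists (fun n => n + list_max (l n))%nat. repeat split.
  - intros a b Hab. cut (list_max (l a) <= list_max (l b))%nat; [lia|].
    apply list_max_le, Forall_forall. intros v Hv. apply Hmax, Hl.
    apply Hl in Hv. destruct Hv as [j [k [H1 [H2 ->]]]].
    exists j, k. lia.
  - intros a. lia.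
  - intros j k n Hj Hk. cut (f j k <= list_max (l n))%nat; [lia|].
    apply Hmax, Hl. exists j, k. lia.
Qed.

(** * Guessable index sets do not cover the line by meager sets *)

(* A code [((a, b), c)] denotes the closed interval of center [(a - b)/(c+1)]
   and radius [1/(c+1)]. *)
Definition rad (j : nat) : R := / INR (S (snd (of_nat j))).

Definition center (j : nat) : R :=
  let p := of_nat (fst (of_nat j)) in (INR (fst p) - INR (snd p)) * rad j.

Definition in_ball (j : nat) (x : R) : Prop :=
  center j - rad j <= x <= center j + rad j.

Lemma rad_pos j : 0 < rad j.
Proof. apply Rinv_0_lt_compat, lt_0_INR. lia. Qed.

Lemma INR_sub_IZR (z : Z) : INR (Z.to_nat z) - INR (Z.to_nat (- z)) = IZR z.
Proof.
  rewrite !INR_IZR_INZ, <- minus_IZR. f_equal. lia.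
Qed.

Lemma small_ball (y eps : R) :
  0 < eps -> exists j, forall x, in_ball j x -> Rabs (x - y) < eps.
Proof.
  (* The center, rounded up, lies within one radius of [y], so points of the interval are within two
     radii, and a radius below [eps / 3] suffices. *)
  intros He. destruct (archimed_cor1 (eps / 3)) as [c [Hc Hc0]]; [lra|].
  destruct c as [|c]; [lia|].
  set (z := up (y * INR (S c))).
  exists (to_nat (to_nat (Z.to_nat z, Z.to_nat (- z)), c)).
  unfold in_ball, center, rad. rewrite !cancel_of_to. cbn [fst snd].
  rewrite cancel_of_to. cbn [fst snd]. rewrite INR_sub_IZR.
  assert (Hp : 0 < INR (S c)) by (apply lt_0_INR; lia).
  destruct (archimed (y * INR (S c))) as [A1 A2]. fold z in A1, A2.
  set (r := / INR (S c)) in *.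
  assert (Hr : 0 < r) by (apply Rinv_0_lt_compat; lra).
  assert (E : y = y * INR (S c) * r) by (unfold r; field; lra).
  assert (B1 : y <= IZR z * r).
  { rewrite E. apply Rmult_le_compat_r; lra. }
  assert (B2 : IZR z * r <= y + r).
  { rewrite E. replace (y * INR (S c) * r + r) with ((y * INR (S c) + 1) * r) by ring.
    apply Rmult_le_compat_r; lra. }
  intros x Hx. apply Rabs_def1; lra.
Qed.

Lemma nowhere_dense_ball (N : R -> Prop) (j : nat) :
  nowhere_dense N ->
  exists j', (forall x, in_ball j' x -> in_ball j x) /\
             (forall x, in_ball j' x -> ~ N x).
Proof.
  intros HN.
  assert (H : exists y, Rabs (y - center j) < rad j /\ ~ closure_R N y).
  { apply NNPP. intros H. apply HN. exists (center j), (rad j).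
    split; [apply rad_pos|]. intros y Hy. apply NNPP. intros Hn. eauto. }
  destruct H as [y [Hy Hc]].
  assert (H : exists eps, 0 < eps /\ forall x, Rabs (y - x) < eps -> ~ N x).
  { apply NNPP. intros H. apply Hc. intros eps He. apply NNPP. intros Hn.
    apply H. exists eps. split; [exact He|]. intros x Hx Nx. eauto. }
  destruct H as [eps [He Hd]].
  (* The first bound keeps the new ball off [N], the second keeps it inside ball [j]. *)
  destruct (small_ball y (Rmin eps (rad j - Rabs (y - center j)))) as [j' Hj'].
  { apply Rmin_glb_lt; lra. }
  exists j'. split; intros x Hx; apply Hj' in Hx.
  - pose proof (Rlt_le_trans _ _ _ Hx (Rmin_r _ _)) as H.
    unfold in_ball. apply Rabs_def2 in Hy as Hy'.
    assert (Ht : Rabs (x - center j) <= Rabs (x - y) + Rabs (y - center j)).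
    { replace (x - center j) with ((x - y) + (y - center j)) by ring. apply Rabs_triang. }
    assert (Hx' : Rabs (x - center j) < rad j) by lra.
    apply Rabs_def2 in Hx'. lra.
  - apply Hd. rewrite Rabs_minus_sym. apply (Rlt_le_trans _ _ _ Hx), Rmin_l.
Qed.

Lemma nowhere_dense_seq_ball (N : nat -> R -> Prop) :
  (forall n, nowhere_dense (N n)) -> forall k j,
  exists j', (forall x, in_ball j' x -> in_ball j x) /\
             (forall n x, (n <= k)%nat -> in_ball j' x -> ~ N n x).
Proof.
  intros HN k j. induction k as [|k [j1 [H1 H2]]].
  - destruct (nowhere_dense_ball (N O) j (HN O)) as [j' [H1 H2]].
    exists j'. split; [exact H1|]. intros n x Hn. replace n with O by lia. apply H2.
  - destruct (nowhere_dense_ball (N (S k)) j1 (HN (S k))) as [j' [H3 H4]].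
    exists j'. split; [auto|]. intros n x Hn Hx.
    destruct (Nat.eq_dec n (S k)) as [->|Hne]; [auto|].
    apply H2; auto; lia.
Qed.

Lemma nested_balls (c : nat -> nat) :
  (forall k x, in_ball (c (S k)) x -> in_ball (c k) x) ->
  exists x, forall k, in_ball (c k) x.
Proof.
  intros Hn.
  assert (Hmon : forall k k' x, (k <= k')%nat -> in_ball (c k') x -> in_ball (c k) x).
  { intros k k' x H. induction H; auto. }
  assert (Hlo : forall k, in_ball (c k) (center (c k) - rad (c k))).
  { intros k. pose proof (rad_pos (c k)). unfold in_ball. lra. }
  assert (Hhi : forall k, in_ball (c k) (center (c k) + rad (c k))).
  { intros k. pose proof (rad_pos (c k)). unfold in_ball. lra. }
  assert (Hle : forall k k', center (c k) - rad (c k) <= center (c k') + rad (c k')).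
  { intros k k'. destruct (le_lt_dec k k') as [H|H].
    - apply (Hmon k k' _ H (Hhi k')).
    - apply (Hmon k' k _ (Nat.lt_le_incl _ _ H) (Hlo k)). }
  (* The supremum of the left endpoints lies in every interval, since nesting puts every left
     endpoint below every right endpoint. *)
  destruct (completeness (fun r => exists k, r = center (c k) - rad (c k)))
    as [x [Hub Hlub]].
  - exists (center (c O) + rad (c O)). intros r [k ->]. apply Hle.
  - exists (center (c O) - rad (c O)), O. reflexivity.
  - exists x. intros k. split.
    + apply Hub. eauto.
    + apply Hlub. intros r [k' ->]. apply Hle.
Qed.

Lemma guessable_not_meager_cover (I : Type) (F : I -> R -> Prop) :
  guessable I -> (forall i, meager (F i)) -> exists x, forall i, ~ F i x.
Proof.
  intros HG HF.
  destruct (choice_fun _ HF) as [N HN].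
  destruct (choice_fun (fun (a : I * nat * nat) j' =>
     (forall x, in_ball j' x -> in_ball (snd (fst a)) x) /\
     (forall n x, (n <= snd a)%nat -> in_ball j' x -> ~ N (fst (fst a)) n x)))
    as [phi0 Hphi0].
  { intros [[i j] k]. apply nowhere_dense_seq_ball, HN. }
  pose (phi := fun i j k => phi0 (i, j, k)).
  assert (Hphi : forall i j k,
     (forall x, in_ball (phi i j k) x -> in_ball j x) /\
     (forall n x, (n <= k)%nat -> in_ball (phi i j k) x -> ~ N i n x))
    by (intros i j k; exact (Hphi0 (i, j, k))).
  clearbody phi. clear Hphi0.
  (* [h i] bounds the codes of all replies to balls with code and stage up to its argument, so a
     jump [h i (n k) <= n (S k)] leaves room for the reply at stage [k]. *)
  destruct (choice_fun _ (fun i => square_bound (phi i))) as [h Hh].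
  destruct (guessable_jump I h HG (fun i => proj1 (Hh i))
             (fun i => proj1 (proj2 (Hh i)))) as [n [Hn Hjump]].
  (* The ball reached at stage [k] depends on earlier guesses, so the guessed object is the table of
     replies to every ball of code at most [n k]. *)
  destruct (guessable_on I (list nat) nil (enc_list (fun a => a))
             (fun i k => (h i (n k) <= n (S k))%nat) HG
             (enc_list_inj _ (fun a b e => e)) Hjump
             (fun i k => map (fun j => phi i j k) (seq 0 (S (n k))))) as [g Hg].
  (* A guess is followed only if it keeps the balls nested and the code within [n (S k)]; otherwise
     the ball stays as it is. *)
  pose (ok := fun k j j' => (j' <= n (S k))%nat /\ forall x, in_ball j' x -> in_ball j x).
  pose (c := fix c k := match k with
             | O => O
             | S k' => let j' := nth (c k') (g k') O in
                 if excluded_middle_informative (ok k' (c k') j') then j' else c k'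
             end).
  assert (Hcn : forall k, (c k <= n k)%nat).
  { induction k as [|k IH]; simpl; [lia|].
    destruct (excluded_middle_informative _) as [[H _]|_]; [exact H|].
    specialize (Hn k). lia. }
  destruct (nested_balls c) as [x Hx].
  { intros k x. simpl. destruct (excluded_middle_informative _) as [[_ H]|_]; auto. }
  assert (Hkn : forall k, (k <= n k)%nat).
  { induction k as [|k IH]; [lia|]. specialize (Hn k). lia. }
  exists x. intros i Fx. destruct (proj2 (HN i) x Fx) as [m Nm].
  (* The piece [N i m] contains [x]; a correct guess at a stage [k >= m] makes the next ball avoid
     it. *)
  destruct (Hg i m) as [k [Hk [Hj E]]].
  assert (En : nth (c k) (g k) O = phi i (c k) k).
  { rewrite <- E.
    rewrite (nth_indep _ O (phi i O k))
      by (rewrite length_map, length_seq; specialize (Hcn k); lia).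
    rewrite (map_nth (fun j => phi i j k)), seq_nth by (specialize (Hcn k); lia).
    reflexivity. }
  assert (Ec : c (S k) = phi i (c k) k).
  { simpl. rewrite En. destruct (excluded_middle_informative _) as [_|H]; [reflexivity|].
    exfalso. apply H. split.
    - eapply Nat.le_trans; [|exact Hj]. apply (proj2 (proj2 (Hh i))); auto.
    - apply Hphi. }
  apply (proj2 (Hphi i (c k) k) m x Hk); [|exact Nm].
  rewrite <- Ec. apply Hx.
Qed.

(* Coordinate [m] of the new family codes the values of the old one at the
   arguments [to_nat (m, p)], [p < K m]; the [p]-th element of [L m] then serves
   as a guess for the [p]-th of them. *)
Lemma unguessable_slalom (I : Type) (K : nat -> nat) :
  ~ guessable I ->
  exists xi : I -> nat -> nat, forall L : nat -> list (nat -> nat),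
    (forall m, length (L m) <= K m)%nat ->
    exists i m0, forall m z, (m0 <= m)%nat -> In z (L m) -> xi i m <> z m.
Proof.
  intros HG. apply not_all_ex_not in HG. destruct HG as [y Hy].
  pose (xi := fun i m => enc_list (fun a : nat => a)
                (map (fun p => y i (to_nat (m, p))) (seq 0 (K m)))).
  exists xi. intros L HL.
  assert (Hxi : forall i i' m p, xi i m = xi i' m -> (p < K m)%nat ->
            y i (to_nat (m, p)) = y i' (to_nat (m, p))).
  { intros i i' m p H Hp. apply enc_list_inj in H; [|intros a b e; exact e].
    apply (ext_in_map H). apply in_seq. lia. }
  (* The value at [to_nat (m, p)] is determined by the [p]-th guess: all [i] with this code at [m]
     share it. *)
  destruct (choice_fun (fun q v => forall i, let (m, p) := of_nat q in
     (p < K m)%nat -> xi i m = nth p (L m) (fun _ => O) m -> y i q = v)) as [g Hg].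
  { intros q. destruct (of_nat q) as [m p] eqn:Eq.
    assert (Hq : q = to_nat (m, p)) by (rewrite <- Eq; symmetry; apply cancel_to_of).
    destruct (classic (exists i, xi i m = nth p (L m) (fun _ => O) m)) as [[i Hi]|H].
    - exists (y i q). intros i' Hp Hi'. rewrite Hq. apply Hxi; [congruence|exact Hp].
    - exists O. intros i _ Hi. exfalso. eauto. }
  (* If every [xi i] were hit by [L] at arbitrarily large [m], then [g] would guess all of [y],
     because [to_nat (m, p) >= m]. *)
  apply NNPP. intros Hno. apply Hy. exists g. intros i M.
  apply NNPP. intros Hne. apply Hno. exists i, M. intros m z Hm Hz E.
  destruct (In_nth _ _ (fun _ => O) Hz) as [p [Hp Ez]].
  apply Hne. exists (to_nat (m, p)).
  pose proof (to_nat_non_decreasing m p).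
  split; [lia|].
  specialize (Hg (to_nat (m, p)) i). rewrite cancel_of_to in Hg.
  apply Hg; [specialize (HL m); lia|]. rewrite Ez. exact E.
Qed.

(** * The metric on Baire space *)

Lemma first_difference (x y : nat -> nat) :
  x <> y -> exists n, (forall k, (k < n)%nat -> x k = y k) /\ x n <> y n.
Proof.
  intros H. destruct (least_nat (fun n => x n <> y n)) as [n [H1 H2]].
  - apply not_all_ex_not. intros H'. apply H, functional_extensionality, H'.
  - exists n. split; [|exact H1]. intros k Hk. apply NNPP. exact (H2 k Hk).
Qed.

Definition baire_dist (x y : nat -> nat) : R :=
  match excluded_middle_informative (x = y) with
  | left _ => 0
  | right H =>
      / INR (S (proj1_sig (constructive_indefinite_description _ (first_difference x y H))))
  end.

Lemma baire_dist_cases (x y : nat -> nat) :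
  (x = y /\ baire_dist x y = 0) \/
  exists n, (forall k, (k < n)%nat -> x k = y k) /\ x n <> y n /\
            baire_dist x y = / INR (S n).
Proof.
  unfold baire_dist. destruct (excluded_middle_informative (x = y)) as [H|H]; [auto|].
  right. destruct (constructive_indefinite_description _ _) as [n [H1 H2]]. simpl.
  exists n. auto.
Qed.

Lemma inv_INR_pos n : 0 < / INR (S n).
Proof. apply Rinv_0_lt_compat, lt_0_INR. lia. Qed.

Lemma inv_INR_le n m : (m <= n)%nat -> / INR (S n) <= / INR (S m).
Proof. intros H. apply Rinv_le_contravar; [apply lt_0_INR; lia|apply le_INR; lia]. Qed.

Lemma inv_INR_lt n m : (m < n)%nat -> / INR (S n) < / INR (S m).
Proof.
  intros H. apply Rinv_lt_contravar; [|apply lt_INR; lia].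
  apply Rmult_lt_0_compat; apply lt_0_INR; lia.
Qed.

(** Small balls are cylinders. Agreement up to [m] is an equivalence relation, which yields symmetry
    and the triangle inequality below. *)
Lemma baire_dist_lt (x y : nat -> nat) (m : nat) :
  baire_dist x y < / INR (S m) <-> forall k, (k <= m)%nat -> x k = y k.
Proof.
  destruct (baire_dist_cases x y) as [[-> E]|[n [H1 [H2 E]]]]; rewrite E.
  - split; [reflexivity|]. intros _. apply inv_INR_pos.
  - split.
    + intros H k Hk. apply H1. destruct (le_lt_dec n k) as [Hn|]; [|assumption].
      pose proof (inv_INR_le m n ltac:(lia)). lra.
    + intros H. apply inv_INR_lt. destruct (le_lt_dec n m) as [Hn|]; [|assumption].
      exfalso. auto.
Qed.

Lemma baire_dist_metric : is_metric baire_dist.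
Proof.
  assert (Hpos : forall x y, 0 <= baire_dist x y).
  { intros x y. destruct (baire_dist_cases x y) as [[_ ->]|[n [_ [_ ->]]]]; [lra|].
    left. apply inv_INR_pos. }
  split; [exact Hpos|]. split; [|split].
  - intros x y. destruct (baire_dist_cases x y) as [[H E]|[n [_ [H2 E]]]]; rewrite E.
    + tauto.
    + split; [pose proof (inv_INR_pos n); lra|]. intros ->. contradiction.
  - assert (H : forall x y, baire_dist x y <= baire_dist y x).
    { intros x y. destruct (baire_dist_cases x y) as [[_ ->]|[n [H1 [H2 ->]]]]; [apply Hpos|].
      apply Rnot_lt_le. intros H. apply H2. symmetry.
      exact (proj1 (baire_dist_lt y x n) H n (le_n n)). }
    intros x y. apply Rle_antisym; apply H.
  - intros x y z.
    destruct (baire_dist_cases x z) as [[_ ->]|[n [H1 [H2 ->]]]].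
    { pose proof (Hpos x y). pose proof (Hpos y z). lra. }
    apply Rnot_lt_le. intros H. apply H2.
    pose proof (Hpos x y). pose proof (Hpos y z).
    transitivity (y n).
    + apply (proj1 (baire_dist_lt x y n)); [lra|lia].
    + apply (proj1 (baire_dist_lt y z n)); [lra|lia].
Qed.

(** The set of values replaces [I] because [xi] may fail to be injective, and distinct points must
    have positive distance. *)
Definition image_space {I : Type} (xi : I -> nat -> nat) : Type :=
  {x : nat -> nat | exists i, x = xi i}.

Definition image_dist {I : Type} (xi : I -> nat -> nat) (x y : image_space xi) : R :=
  baire_dist (proj1_sig x) (proj1_sig y).

Lemma image_ext {I : Type} (xi : I -> nat -> nat) (x y : image_space xi) :
  proj1_sig x = proj1_sig y -> x = y.
Proof.
  destruct x as [x Hx], y as [y Hy]. simpl. intros ->. f_equal. apply proof_irrelevance.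
Qed.

Lemma image_metric {I : Type} (xi : I -> nat -> nat) : is_metric (image_dist xi).
Proof.
  destruct baire_dist_metric as [H1 [H2 [H3 H4]]]. unfold image_dist.
  split; [auto|]. split; [|split; auto].
  intros x y. rewrite H2. split; [apply image_ext|congruence].
Qed.

Lemma image_separable {I : Type} (xi : I -> nat -> nat) : separable (image_dist xi).
Proof.
  pose (pre := fun (x : image_space xi) m =>
          enc_list (fun a : nat => a) (map (proj1_sig x) (seq 0 (S m)))).
  assert (Hpre : forall x y m, pre x m = pre y m -> image_dist xi x y < / INR (S m)).
  { intros x y m H. apply enc_list_inj in H; [|intros a b e; exact e].
    apply baire_dist_lt. intros k Hk. apply (ext_in_map H). apply in_seq. lia. }
  pose (Q := fun (q : nat) (x : image_space xi) => exists m, q = to_nat (m, pre x m)).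
  (* One point is kept for each length and initial segment that occurs; [None] is available for the
     remaining codes, even in an empty space. *)
  destruct (choice_fun (fun q (o : option (image_space xi)) =>
     (exists x, Q q x) -> exists x, o = Some x /\ Q q x)) as [pick Hpick].
  { intros q. destruct (classic (exists x, Q q x)) as [[x Hx]|H].
    - exists (Some x). eauto.
    - exists None. tauto. }
  exists (fun x => exists q, pick q = Some x). split.
  - destruct (choice_fun (fun (x : image_space xi) q =>
       (exists q', pick q' = Some x) -> pick q = Some x)) as [f Hf].
    { intros x. destruct (classic (exists q', pick q' = Some x)) as [[q H]|H];
        [exists q; auto|exists O; tauto]. }
    exists f. intros x y Hx Hy E. apply Hf in Hx. apply Hf in Hy. congruence.
  - intros x eps He. destruct (archimed_cor1 eps He) as [[|m] [Hm Hm0]]; [lia|].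
    destruct (Hpick (to_nat (m, pre x m))) as [y [Hy [m' E]]].
    { exists x, m. reflexivity. }
    exists y. split; [eauto|].
    apply to_nat_inj, pair_equal_spec in E. destruct E as [<- E].
    specialize (Hpre x y m E). lra.
Qed.

(** * Hausdorff dimension *)

Lemma sum_ge_count (a : nat -> R) (c : R) (l : list nat) (N : nat) :
  (forall n, 0 <= a n) -> NoDup l ->
  (forall n, In n l -> (n <= N)%nat /\ c <= a n) ->
  INR (length l) * c <= sum_f_R0 a N.
Proof.
  intros Ha. revert l. induction N as [|N IH]; intros l Hd Hl.
  - destruct l as [|b [|b' l]]; simpl.
    + specialize (Ha O). lra.
    + destruct (Hl b) as [H1 H2]; [left; reflexivity|].
      replace b with O in H2 by lia. lra.
    + inversion Hd as [|? ? Hn _]. exfalso. apply Hn. left.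
      destruct (Hl b) as [H1 _]; [left; reflexivity|].
      destruct (Hl b') as [H2 _]; [right; left; reflexivity|]. lia.
  - destruct (classic (In (S N) l)) as [H|H].
    + destruct (in_split _ _ H) as [l1 [l2 ->]].
      pose proof (proj2 (Hl _ H)) as Hc.
      apply NoDup_remove in Hd. destruct Hd as [Hd Hn].
      specialize (IH (l1 ++ l2) Hd). rewrite length_app in IH |- *. cbn [length].
      rewrite Nat.add_succ_r, S_INR. cbn [sum_f_R0].
      cut (INR (length l1 + length l2) * c <= sum_f_R0 a N); [lra|].
      apply IH. intros n Hin.
      destruct (Hl n) as [H1 H2].
      { apply in_app_iff in Hin. apply in_app_iff. simpl. tauto. }
      split; [|exact H2]. assert (n <> S N) by congruence. lia.
    + cbn [sum_f_R0]. specialize (Ha (S N)).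
      cut (INR (length l) * c <= sum_f_R0 a N); [lra|].
      apply IH; [exact Hd|]. intros n Hin. destruct (Hl n Hin) as [H1 H2].
      split; [|exact H2]. assert (n <> S N) by congruence. lia.
Qed.

Lemma bounded_enumeration (P : nat -> Prop) (K : nat) :
  (forall l, NoDup l -> (forall n, In n l -> P n) -> (length l <= K)%nat) ->
  exists l, (length l <= K)%nat /\ forall n, P n -> In n l.
Proof.
  intros HK. apply NNPP. intros Hno.
  assert (H : forall k, exists l, length l = k /\ NoDup l /\ forall n, In n l -> P n).
  { induction k as [|k [l [H1 [H2 H3]]]].
    - exists nil. repeat split; [constructor|contradiction].
    - assert (Hn : exists n, P n /\ ~ In n l).
      { apply NNPP. intros H. apply Hno. exists l. split; [auto|].
        intros n Pn. apply NNPP. eauto. }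
      destruct Hn as [n [Pn Hn]]. exists (n :: l). repeat split.
      + simpl. congruence.
      + constructor; auto.
      + intros b [<-|Hb]; auto. }
  destruct (H (S K)) as [l [H1 [H2 H3]]]. specialize (HK l H2 H3). lia.
Qed.

(** Since [1 / (m + 1) <= 1], raising the exponent from [t] to the integer [D] can only shrink the
    power; counts can then stay in [nat]. *)
Lemma Rpower_inv_ge (m D : nat) (t : R) :
  t <= INR D -> / INR (S m ^ D) <= Rpower (/ INR (S m)) t.
Proof.
  intros Ht. assert (Hp : 0 < INR (S m)) by (apply lt_0_INR; lia).
  rewrite pow_INR, <- Rpower_pow, <- Rpower_Ropp by exact Hp.
  unfold Rpower. rewrite ln_Rinv by exact Hp.
  assert (Hl : 0 <= ln (INR (S m))).
  { rewrite <- ln_1. destruct (le_INR 1 (S m) ltac:(lia)) as [H|<-]; [|simpl; lra].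
    left. apply ln_increasing; [lra|exact H]. }
  assert (Hm : - INR D * ln (INR (S m)) <= t * - ln (INR (S m))) by nra.
  destruct Hm as [Hm|Hm]; [left; apply exp_increasing; exact Hm|rewrite Hm; lra].
Qed.

(** Each of these sets contributes at least [1 / (m + 1) ^ D] to a sum below one. *)
Lemma few_large_sets (r : nat -> R) (t l : R) (m D : nat) :
  0 < t -> t <= INR D -> l < 1 ->
  (forall N, sum_f_R0 (fun n => Rpower (r n) t) N <= l) ->
  exists L, (length L <= S m ^ D)%nat /\ forall n, / INR (S m) <= r n -> In n L.
Proof.
  intros Ht HD Hl Hs. apply bounded_enumeration. intros L Hd HL.
  assert (H : INR (length L) * / INR (S m ^ D) <= l).
  { eapply Rle_trans; [|apply (Hs (list_max L))].
    apply sum_ge_count; [intros n; left; apply exp_pos|exact Hd|].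
    intros n Hn. split.
    - pose proof (proj1 (list_max_le L _) (le_n _)) as HF.
      rewrite Forall_forall in HF. auto.
    - eapply Rle_trans; [apply (Rpower_inv_ge m D t HD)|].
      apply Rle_Rpower_l; [lra|]. split; [apply inv_INR_pos|auto]. }
  assert (Hp : 0 < INR (S m ^ D)).
  { apply lt_0_INR. pose proof (Nat.pow_nonzero (S m) D). lia. }
  apply INR_le. apply (Rmult_le_reg_r (/ INR (S m ^ D))).
  - apply Rinv_0_lt_compat, Hp.
  - rewrite Rinv_r by lra. lra.
Qed.

Lemma level (r : R) (j : nat) :
  0 < r -> r < / INR (S j) ->
  exists m, (j <= m)%nat /\ / INR (S (S m)) <= r < / INR (S m).
Proof.
  intros H0 Hj.
  destruct (least_nat (fun n => / INR (S n) <= r)) as [n [H1 H2]].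
  { destruct (archimed_cor1 r H0) as [[|n] [H1 H2]]; [lia|]. exists n. lra. }
  assert (Hn : (j < n)%nat).
  { destruct (le_lt_dec n j) as [H|]; [|assumption].
    pose proof (inv_INR_le j n H). lra. }
  destruct n as [|m]; [lia|]. exists m. split; [lia|]. split; [exact H1|].
  apply Rnot_le_lt. apply H2. lia.
Qed.

(** [L m] takes one point from every set of size at least [1 / (m + 2)] in the first [m + 1] covers.
    If [xi i] avoids these from [m0] on, a set of cover [m0] containing it has size in
    [[1 / (m + 2), 1 / (m + 1))] for some [m >= m0], so its chosen point agrees with [xi i] up to
    [m], a contradiction. *)
Lemma image_dimension {I : Type} (xi : I -> nat -> nat) (s : R) (D : nat) :
  s <= INR D ->
  (forall L : nat -> list (nat -> nat),
    (forall m, length (L m) <= S m * S (S m) ^ D)%nat ->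
    exists i m0, forall m z, (m0 <= m)%nat -> In z (L m) -> xi i m <> z m) ->
  dimH_ge (image_dist xi) s.
Proof.
  intros HD Hxi t Ht Hts Hnull.
  (* The bound [1 / (j + 2)], strictly below [1 / (j + 1)], is what [level] needs to return an
     [m >= j]. *)
  assert (Hcov : forall j : nat, exists Ur : (nat -> image_space xi -> Prop) * (nat -> R),
     (forall x, exists n, fst Ur n x) /\
     (forall n, 0 < snd Ur n /\ snd Ur n <= / INR (S (S j)) /\
                diam_le (image_dist xi) (fst Ur n) (snd Ur n)) /\
     exists l, l < 1 /\ forall N, sum_f_R0 (fun n => Rpower (snd Ur n) t) N <= l).
  { intros j. destruct (Hnull _ (inv_INR_pos (S j)) 1 Rlt_0_1) as [U [r H]].
    exists (U, r). exact H. }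
  apply choice_fun in Hcov. destruct Hcov as [Ur HU].
  destruct (choice_fun (fun (jm : nat * nat) L =>
     (length L <= S (S (snd jm)) ^ D)%nat /\
     forall n, / INR (S (S (snd jm))) <= snd (Ur (fst jm)) n -> In n L)) as [L0 HL0].
  { intros [j m]. destruct (HU j) as [_ [_ [l [Hl Hs]]]].
    apply (few_large_sets _ t l); auto. lra. }
  destruct (choice_fun (fun (jn : nat * nat) (z : nat -> nat) =>
     forall x, fst (Ur (fst jn)) (snd jn) x ->
     exists x', fst (Ur (fst jn)) (snd jn) x' /\ proj1_sig x' = z)) as [rep Hrep].
  { intros [j n]. simpl. destruct (classic (exists x, fst (Ur j) n x)) as [[x Hx]|H].
    - exists (proj1_sig x). eauto.
    - exists (fun _ => O). intros x Hx. exfalso. eauto. }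
  destruct (Hxi (fun m => flat_map (fun j => map (fun n => rep (j, n)) (L0 (j, m)))
                            (seq 0 (S m)))) as [i [m0 Hi]].
  { intros m.
    assert (H : forall a b, (length (flat_map (fun j => map (fun n => rep (j, n)) (L0 (j, m)))
                 (seq a b)) <= b * S (S m) ^ D)%nat).
    { intros a b. revert a. induction b as [|b IH]; intros a; [simpl; lia|].
      cbn [seq flat_map]. rewrite length_app, length_map.
      specialize (IH (S a)). pose proof (proj1 (HL0 (a, m))) as Ha. simpl snd in Ha.
      rewrite Nat.mul_succ_l. lia. }
    apply H. }
  pose (x := exist (fun x => exists i, x = xi i) (xi i) (ex_intro _ i eq_refl)
             : image_space xi).
  destruct (HU m0) as [Hx [Hr _]]. destruct (Hx x) as [n Un].
  destruct (Hr n) as [H0 [Hle Hdiam]].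
  destruct (level (snd (Ur m0) n) m0 H0) as [m [Hm [Hlo Hhi]]].
  { eapply Rle_lt_trans; [exact Hle|apply inv_INR_lt; lia]. }
  destruct (Hrep (m0, n) x Un) as [x' [Ux' Ex']]. simpl in Ux'.
  apply (Hi m (rep (m0, n)) Hm).
  - apply in_flat_map. exists m0. split; [apply in_seq; lia|].
    apply (in_map (fun n => rep (m0, n))). apply (proj2 (HL0 (m0, m))). exact Hlo.
  - rewrite <- Ex'. apply (proj1 (baire_dist_lt (xi i) (proj1_sig x') m)); [|lia].
    eapply Rle_lt_trans; [|exact Hhi]. exact (Hdiam x x' Un Ux').
Qed.

(** * Cardinality *)

Lemma injective_comp {A B C : Type} (f : A -> B) (g : B -> C) :
  injective f -> injective g -> injective (fun x => g (f x)).
Proof. intros Hf Hg x y H. auto. Qed.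

Lemma image_card_lt {I : Type} (xi : I -> nat -> nat) (B : Type) :
  card_lt I B -> card_lt (image_space xi) B.
Proof.
  intros [[f Hf] Hn].
  assert (H : exists k : image_space xi -> I, injective k).
  { destruct (choice_fun (fun (x : image_space xi) i => proj1_sig x = xi i)) as [k Hk].
    - intros [x Hx]. exact Hx.
    - exists k. intros x y E. apply image_ext. rewrite Hk, E, <- Hk. reflexivity. }
  destruct H as [k Hk]. split.
  - exists (fun x => f (k x)). apply injective_comp; assumption.
  - intros [g Hg]. apply Hn. exists (fun x => k (g x)). apply injective_comp; assumption.
Qed.

Lemma real_embeds_interval (J : R -> Prop) :
  interval J -> nondegenerate J ->
  exists p : R -> R, injective p /\ forall r, J (p r).
Proof.
  intros HJ [x [y [Jx [Jy Hxy]]]].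
  pose proof PI_RGT_0 as Hpi.
  (* The arctangent is rescaled from [(- PI / 2, PI / 2)] to [(0, 1)] and then to [(x, y)]. *)
  exists (fun r => x + (y - x) * ((atan r + PI / 2) / PI)). split.
  - intros a b H. rewrite <- (tan_atan a), <- (tan_atan b). f_equal.
    apply Rplus_eq_reg_l in H. apply Rmult_eq_reg_l in H; [|lra].
    unfold Rdiv in H. apply Rmult_eq_reg_r in H; [lra|].
    apply Rinv_neq_0_compat. lra.
  - intros r. apply (HJ x _ y Jx Jy). destruct (atan_bound r) as [H1 H2].
    set (q := (atan r + PI / 2) / PI).
    assert (Hq : q * PI = atan r + PI / 2) by (unfold q; field; lra).
    assert (0 <= q <= 1) by (split; nra). nra.
Qed.

Lemma card_lt_not_onto_interval (X : Type) :
  card_lt X R -> forall J : R -> Prop, interval J -> nondegenerate J ->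
  ~ exists f : X -> R, maps_onto f J.
Proof.
  intros [_ Hn] J HJ Hd [f [_ Hf]].
  destruct (real_embeds_interval J HJ Hd) as [p [Hp Jp]].
  destruct (choice_fun (fun r x => f x = p r) (fun r => Hf (p r) (Jp r))) as [g Hg].
  apply Hn. exists g. intros a b E. apply Hp. rewrite <- !Hg, E. reflexivity.
Qed.

Theorem theorem3p3 :
  cov_M_lt_c ->
  forall s : R, 0 < s ->
    exists (X : Type) (d : X -> X -> R),
      is_metric d /\ separable d /\ dimH_ge d s /\ card_lt X R /\
      (forall I : R -> Prop, interval I -> nondegenerate I ->
         ~ exists f : X -> R, maps_onto f I).
Proof.
  intros [I [F [Hlt [HF Hcov]]]] s Hs.
  assert (HG : ~ guessable I).
  { intros HG. destruct (guessable_not_meager_cover I F HG HF) as [x Hx].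
    destruct (Hcov x) as [i Hi]. exact (Hx i Hi). }
  assert (HD : exists D : nat, s <= INR D).
  { destruct (archimed s) as [H _]. exists (Z.to_nat (up s)).
    rewrite INR_IZR_INZ, Z2Nat.id; [lra|]. apply le_IZR. lra. }
  destruct HD as [D HD].
  (* At coordinate [m] room is needed for the [m + 1] covers in use, each with at most [(m + 2) ^ D]
     sets of size at least [1 / (m + 2)]. *)
  destruct (unguessable_slalom I (fun m => S m * S (S m) ^ D)%nat HG) as [xi Hxi].
  pose proof (image_card_lt xi R Hlt) as Hcard.
  exists (image_space xi), (image_dist xi).
  split; [apply image_metric|]. split; [apply image_separable|].
  split; [exact (image_dimension xi s D HD Hxi)|].
  split; [exact Hcard|]. exact (card_lt_not_onto_interval _ Hcard).
Qed.
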